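(* Let $n$ and $k$ be integers with $2\le k\le n-2$, and let $\mathfrak{T}(n,k)$ be the set of trees of order $n$ with exactly $k$ pendant vertices. If $T\in\mathfrak{T}(n,k)$ satisfies $\rho_L(T)=\max\{\rho_L(T'):T'\in\mathfrak{T}(n,k)\}$, then $T\in\mathfrak{D}(n,k)$, i.e. $T\cong T(n,k;t_1,t_2)$ for some integers $t_1\ge1$, $t_2\ge1$ with $t_1+t_2=k$.
   Context: All graphs are simple, finite and connected. For a connected graph $G$ with vertex set $\{v_1,\dots,v_n\}$, $d_G(u,v)$ is the distance between $u$ and $v$, and the transmission of $u$ is $Tr_G(u)=\sum_{v\in V(G)}d_G(u,v)$. Let $Tr(G)$ be the diagonal matrix with $(i,i)$-entry $Tr_G(v_i)$ and $D(G)=(d_G(v_i,v_j))$ the distance matrix. The distance Laplacian matrix is $L_D(G)=Tr(G)-D(G)$ and $\rho_L(G)$ denotes its largest eigenvalue (the distance Laplacian spectral radius). A pendant vertex is a vertex of degree $1$. For integers $t_1,t_2\ge1$ with $t_1+t_2=k$ and $\ell=n-k\ge2$, $T(n,k;t_1,t_2)$ denotes the tree obtained from a path $P_\ell$ of order $\ell$ by attaching $t_1$ pendant vertices (each joined by an edge) to one end vertex of the path and $t_2$ pendant vertices to the other end vertex; it has order $n$. $\mathfrak{D}(n,k)=\{T(n,k;t_1,t_2): t_1\ge1,\ t_2\ge1,\ t_1+t_2=k\}$. *)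

(* Defs.v *)
From mathcomp Require Import all_boot all_order all_algebra.
From mathcomp Require Import boolp classical_sets reals.
From mathcomp Require Import polyrcf.

Set Implicit Arguments.
Unset Strict Implicit.
Unset Printing Implicit Defensive.

Import Order.TTheory GRing.Theory Num.Theory.
Local Open Scope ring_scope.

Record sgraph (V : finType) := SGraph {
  adj :> rel V;
  adj_sym : symmetric adj;
  adj_irr : irreflexive adj }.

Section Graphs.
Variables (V : finType) (G : sgraph V).

Definition connected_graph : Prop := forall u v, connect G u v.

(* A closed walk u, v, u is a ucycle of size 2, hence the size condition. *)
Definition acyclic_graph : Prop :=
  forall c : seq V, (2 < size c)%N -> ~~ ucycleb G c.

Definition tree : Prop := connected_graph /\ acyclic_graph.

Definition degree (u : V) : nat := #|[set v | G u v]|.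

Definition pendant : {set V} := [set u | degree u == 1%N].

Definition has_walk (u v : V) (m : nat) : bool :=
  [exists p : m.-tuple V, path G u p && (last u p == v)].

(* The least length of a walk from u to v; it is less than #|V| whenever there
   is one, and the value is the junk #|V| when there is none. *)
Definition gdist (u v : V) : nat := find (has_walk u v) (iota 0 #|V|).

Definition transmission (u : V) : nat := (\sum_v gdist u v)%N.

Lemma gdistP (u v : V) : connect G u v ->
  has_walk u v (gdist u v) /\ forall m, has_walk u v m -> (gdist u v <= m)%N.
Proof.
case/connectP=> q; case/shortenP=> p Gp Up _ -> {q v}.
have szp : (size p < #|V|)%N.
  by rewrite -[(size p).+1]/(size (u :: p)) -(card_uniqP Up) max_card.
have walk_p : has_walk u (last u p) (size p).
  by apply/existsP; exists (in_tuple p); rewrite Gp eqxx.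
have has_p : has (has_walk u (last u p)) (iota 0 #|V|).
  by apply/hasP; exists (size p); rewrite ?mem_iota.
have lt_d : (gdist u (last u p) < #|V|)%N.
  by rewrite -[X in (_ < X)%N](size_iota 0) -has_find.
split=> [|m walk_m]; first by have := nth_find 0 has_p; rewrite nth_iota.
rewrite leqNgt; apply/negP=> lt_m; have := before_find 0 lt_m.
by rewrite nth_iota ?add0n ?walk_m // (ltn_trans lt_m lt_d).
Qed.
End Graphs.

Definition graph_iso (V W : finType) (G : sgraph V) (H : sgraph W) : Prop :=
  exists2 f : V -> W, bijective f & forall u v, H (f u) (f v) = G u v.

Definition trees_with_pendants (n k : nat) (G : sgraph 'I_n) : Prop :=
  tree G /\ #|pendant G| = k.
Arguments trees_with_pendants : clear implicits.

Section DistanceLaplacian.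
Variables (R : realType) (n : nat) (G : sgraph 'I_n).

Definition transmission_mx : 'M[R]_n :=
  diag_mx (\row_i (transmission G i)%:R).

Definition distance_mx : 'M[R]_n := \matrix_(i, j) (gdist G i j)%:R.

Definition distance_laplacian : 'M[R]_n := transmission_mx - distance_mx.

Definition rhoL : R := sup [set a | eigenvalue distance_laplacian a]%classic.

(* The supremum is attained: rhoL is the largest eigenvalue. *)
Lemma rhoL_largest : (0 < n)%N ->
  eigenvalue distance_laplacian rhoL /\
  forall a, eigenvalue distance_laplacian a -> a <= rhoL.
Proof.
move=> n_gt0; rewrite /rhoL; set A := distance_laplacian.
have A1 : A *m (const_mx 1 : 'cV_n) = 0.
  apply/matrixP=> i j; rewrite !mxE; under eq_bigr => h _ do rewrite !mxE mulr1.
  rewrite sumrB (bigD1 i) //= eqxx mulr1n big1 => [|h /negPf hi]; last first.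
    by rewrite eq_sym hi mulr0n.
  by rewrite addr0 /transmission natr_sum subrr.
have eig0 : eigenvalue A 0.
  rewrite /eigenvalue /eigenspace raddf0 subr0 kermx_eq0 row_free_unit.
  apply/negP=> /mulKmx/(_ (const_mx 1 : 'cV_n))/matrixP/(_ (Ordinal n_gt0) 0).
  by rewrite A1 mulmx0 !mxE => /eqP; rewrite eq_sym oner_eq0.
have cA_neq0 := monic_neq0 (char_poly_monic A).
have eigE a : eigenvalue A a = (a \in rootsR (char_poly A)).
  by rewrite -roots_on_rootsR // inE /= eigenvalue_root_char.
have [m eig_m max_m] :
    exists2 m, eigenvalue A m & forall a, eigenvalue A a -> a <= m.
  have: rootsR (char_poly A) != [::].
    by apply: contraL eig0 => /eqP s0; rewrite eigE s0.
  suff: forall s : seq R, s != [::] ->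
      exists2 m, m \in s & forall a, a \in s -> a <= m.
    move=> max_s /max_s[m sm max_m]; exists m; first by rewrite eigE.
    by move=> a; rewrite eigE => /max_m.
  elim=> // x [|y s] IHs _.
    by exists x => [|a]; rewrite inE // => /eqP->.
  have [//|m sm max_m] := IHs; have [le_xm|lt_mx] := leP x m.
    by exists m => [|a]; rewrite inE ?sm ?orbT // => /predU1P[->|/max_m].
  exists x => [|a]; rewrite inE ?eqxx // => /predU1P[->|/max_m le_am] //.
  exact: le_trans le_am (ltW lt_mx).
suff -> : sup [set a | eigenvalue A a]%classic = m by [].
apply/le_anti/andP; split; first by apply: ge_sup => //; exists 0.
by apply: ub_le_sup => //; exists m.
Qed.
End DistanceLaplacian.

(* 'I_l is the path; the t1 vertices of 'I_t1 hang from its vertex 0 and the t2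
   vertices of 'I_t2 from its vertex l - 1. *)
Definition double_broom_adj (l t1 t2 : nat) : rel ('I_l + 'I_t1 + 'I_t2) :=
  fun x y => match x, y with
  | inl (inl i), inl (inl j) => (i.+1 == j :> nat) || (j.+1 == i :> nat)
  | inl (inl i), inl (inr _) | inl (inr _), inl (inl i) => i == 0%N :> nat
  | inl (inl i), inr _ | inr _, inl (inl i) => i.+1 == l
  | _, _ => false
  end.

Lemma double_broom_sym l t1 t2 : symmetric (@double_broom_adj l t1 t2).
Proof. by move=> [[i|i]|i] [[j|j]|j] //=; rewrite orbC. Qed.

Lemma double_broom_irr l t1 t2 : irreflexive (@double_broom_adj l t1 t2).
Proof. by move=> [[i|i]|i] //=; rewrite gtn_eqF. Qed.

(* T(n, k; t1, t2), meant for t1 + t2 = k, when it has n vertices *)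
Definition double_broom (n k t1 t2 : nat) : sgraph ('I_(n - k) + 'I_t1 + 'I_t2)%type :=
  SGraph (@double_broom_sym (n - k) t1 t2) (@double_broom_irr (n - k) t1 t2).

(* Main.v *)
(* Let x be an eigenvector for the largest eigenvalue rho of a maximal tree T.
   The quadratic form of the distance Laplacian is the sum over pairs of
   d(u, v) (x_u - x_v)^2.  Let w be a vertex with three neighbours b, w1, w2, of
   which w1 and w2 are not pendant, and let B be the branch hanging from w by the
   edge wb.  Reattaching B at wi gives a tree T_i with the same pendant vertices,
   and changes the form at x by the sum over a outside B of
   (d(a, wi) - d(a, w)) g(a), where g(a) is the sum over v in B of
   (x_a - x_v)^2.  By maximality both changes are at most 0; since distances in a
   tree are convex along w1 w w2, their sum is at least 2 g(w) >= 0.  So both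
   vanish, g(w) = 0, and x is an eigenvector for rho in T_1 as well; comparing the
   two eigenvector equations at a outside B shows that x_a is the mean of x over
   B.  Hence x is constant and rho = 0, which is absurd.
   So a vertex of degree at least 3 has at most one non-pendant neighbour.  A
   longest path of non-pendant vertices then contains all of them, and pendant
   vertices are adjacent to its ends only. *)
Require Import Defs.
From mathcomp Require Import boolp classical_sets topology normedtype derive.
From mathcomp Require Import all_boot all_order all_algebra reals.
From mathcomp Require Import zify ring lra.

Set Implicit Arguments.
Unset Strict Implicit.
Unset Printing Implicit Defensive.

Import Order.TTheory GRing.Theory Num.Theory.
Import numFieldNormedType.Exports.
Local Open Scope ring_scope.

(** * Rayleigh quotients of symmetric matrices *)

Definition qform (R : pzRingType) n (A : 'M[R]_n) (x : 'rV[R]_n) : R :=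
  (x *m A *m x^T) 0 0.

Lemma qformE (R : comNzRingType) n (A : 'M[R]_n) x :
  qform A x = \sum_j \sum_i x 0 i * A i j * x 0 j.
Proof. by rewrite /qform mxE; apply: eq_bigr => j _; rewrite !mxE mulr_suml. Qed.

Lemma qformZ (R : comNzRingType) n (A : 'M[R]_n) a x :
  qform A (a *: x) = a ^+ 2 * qform A x.
Proof.
by rewrite /qform linearZ -!scalemxAl -scalemxAr !mxE mulrA expr2.
Qed.

Lemma qformB (R : comNzRingType) n (A B : 'M[R]_n) x :
  qform (A - B) x = qform A x - qform B x.
Proof. by rewrite /qform mulmxBr mulmxBl !mxE. Qed.

Lemma qform_scalar (R : comNzRingType) n (a : R) (x : 'rV[R]_n) :
  qform a%:M x = a * \sum_i x 0 i ^+ 2.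
Proof.
rewrite /qform mul_mx_scalar -scalemxAl !mxE; congr (_ * _).
by apply: eq_bigr => i _; rewrite mxE expr2.
Qed.

Lemma qform_continuous (R : realType) n (A : 'M[R]_n) : continuous (qform A).
Proof.
rewrite (_ : qform A = fun x => \sum_j \sum_i x 0 i * A i j * x 0 j).
  have sumC I (r : seq I) (F : I -> 'rV[R]_n -> R) :
      (forall i, continuous (F i)) -> continuous (fun x => \sum_(i <- r) F i x).
    move=> cF; elim: r => [|i r IHr].
      rewrite (_ : (fun x => _) = (fun=> 0)); first exact: cst_continuous.
      by apply/funext => x; rewrite big_nil.
    rewrite (_ : (fun x => _) = (fun x => F i x + \sum_(j <- r) F j x)).
      by move=> x; exact: (continuousD (cF i x) (IHr x)).
    by apply/funext => x; rewrite big_cons.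
  apply: (sumC) => j; apply: (sumC) => i x.
  have ci k : {for x, continuous (fun x : 'rV[R]_n => x 0 k)} by exact: coord_continuous.
  apply: (continuousM (continuousM (ci i) _) (ci j)); exact: cst_continuous.
by apply/funext => y; rewrite qformE.
Qed.

(* Perturb [x] along [x *m A]. *)
Lemma psd_qform_eq0 (R : realFieldType) n (A : 'M[R]_n) x :
  A^T = A -> (forall y, 0 <= qform A y) -> qform A x = 0 -> x *m A = 0.
Proof.
move=> symA psd qx0.
(* The existential makes [y] opaque, so that expanding the form treats it as a variable. *)
have [y yE] : exists y, y = x *m A by exists (x *m A).
pose s := \sum_i y 0 i ^+ 2.
have qxy t : qform A (x + t *: y) = t * (2 * s + t * qform A y).
  have yy : (y *m y^T) 0 0 = s.
    by rewrite mxE; apply: eq_bigr => i _; rewrite mxE expr2.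
  have yAx : (y *m A *m x^T) 0 0 = s by rewrite -yy -mulmxA -{1}symA -trmx_mul yE.
  rewrite /qform linearD linearZ /= !mulmxDl !mulmxDr -!scalemxAl -!scalemxAr.
  move: qx0; rewrite /qform -yE !mxE => ->.
  move: yy yAx; rewrite !mxE => -> ->; ring.
have s_ge0 : 0 <= s by apply: sumr_ge0 => i _; exact: sqr_ge0.
have p_ge0 := psd y; set p := qform A y in qxy p_ge0.
have s0 : s = 0.
  apply/eqP; rewrite eq_le s_ge0 andbT leNgt; apply/negP => s_gt0.
  (* The minimising step would be [- s / p], but [p] may vanish; with [p + 1] instead the value is
     [- (s / (p + 1)) ^+ 2 * (p + 2)], still negative. *)
  have := psd (x + (- s / (p + 1)) *: y); rewrite qxy leNgt => /negP; apply.
  have p1 : 0 < p + 1 by rewrite ltr_wpDl.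
  rewrite (_ : - s / (p + 1) * (_ + _) = - ((s / (p + 1)) ^+ 2 * (p + 2)));
    last by field; rewrite gt_eqF.
  by rewrite oppr_lt0 mulr_gt0 ?exprn_gt0 ?divr_gt0 // ltr_wpDl.
rewrite -yE; apply/rowP => i; rewrite [RHS]mxE; apply/eqP; rewrite -sqrf_eq0.
have /(psumr_eq0P (fun i _ => sqr_ge0 (y 0 i))) := s0.
by move=> /(_ i isT) ->.
Qed.

(** The form attains its maximum [m] on the compact unit sphere, say at [c]. By homogeneity the form
    of [m%:M - A] is nonnegative, and it vanishes at [c], so [psd_qform_eq0] makes [c] an
    eigenvector. *)
Lemma symmetric_max_eigenvalue (R : realType) n (A : 'M[R]_n) :
  (0 < n)%N -> A^T = A ->
  exists2 m, eigenvalue A m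
    & forall y, qform A y <= m * \sum_i y 0 i ^+ 2.
Proof.
case: n A => // n A _ symA.
pose S := [set x : 'rV[R]_n.+1 | qform 1%:M x = 1]%classic.
have S0 : (S !=set0)%classic.
  exists (delta_mx 0 0); rewrite /S /= qform_scalar mul1r (bigD1 0) //= big1.
    by rewrite mxE !eqxx expr1n addr0.
  by move=> i /negPf i0; rewrite mxE i0 andbF expr0n.
have cS : compact S.
  (* The sphere is a closed subset of a cube, which is compact as a product of segments. *)
  have cube : compact [set v : 'rV[R]_n.+1 | forall i, (v ord0 i \in `[-1, 1])%R]%classic.
    apply: (@rV_compact _ _ (fun=> `[(-1 : R), 1]%classic)) => _.
    exact: segment_compact.
  apply: subclosed_compact cube _.
  - have cont1 : {in (~` S)%classic, continuous (qform (1%:M : 'M[R]_n.+1))}.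
      by move=> ? _; exact: qform_continuous.
    exact: (preimage_closed cont1 (@closed_eq R 1)).
  move=> x; rewrite /S /= qform_scalar mul1r => x1 i.
  rewrite in_itv /= -ler_norml -(@ler_pXn2r _ 2) ?nnegrE // expr1n real_normK ?num_real //.
  by rewrite -x1 (bigD1 i) //= lerDl sumr_ge0 // => j _; exact: sqr_ge0.
have [c c_in cmax] := EVT_max_rV S0 cS (continuous_subspaceT (@qform_continuous _ _ A)).
have qc1 : qform 1%:M c = 1 := set_mem c_in.
pose m := qform A c.
have mP y : qform A y <= m * \sum_i y 0 i ^+ 2.
  set s := \sum_i _.
  have s_ge0 : 0 <= s by apply: sumr_ge0 => i _; exact: sqr_ge0.
  have [s0|s_neq0] := eqVneq s 0.
    suff -> : y = 0 by rewrite /qform !mul0mx s0 mulr0 mxE.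
    apply/rowP => i; rewrite [RHS]mxE; apply/eqP; rewrite -sqrf_eq0.
    by have /(psumr_eq0P (fun i _ => sqr_ge0 (y 0 i)))/(_ i isT) -> := s0.
  have s_gt0 : 0 < s by rewrite lt_def s_neq0.
  have yS : S ((Num.sqrt s)^-1 *: y).
    by rewrite /S /= qformZ qform_scalar mul1r exprVn sqr_sqrtr // mulVf.
  have := cmax _ (mem_set yS); rewrite qformZ exprVn sqr_sqrtr //.
  by rewrite ler_pdivrMl // mulrC.
exists m => //; apply/eigenvalueP; exists c; last first.
  apply: contra_eq_neq qc1 => ->; rewrite /qform !mul0mx mxE eq_sym.
  exact: oner_neq0.
apply/eqP; rewrite eq_sym -subr_eq0 -mul_mx_scalar -mulmxBr; apply/eqP/psd_qform_eq0.
- by rewrite linearB /= tr_scalar_mx symA.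
- by move=> y; rewrite qformB qform_scalar subr_ge0.
- rewrite qformB qform_scalar; move: qc1; rewrite qform_scalar mul1r => ->.
  by rewrite mulr1 subrr.
Qed.

(** * Distances across a bridge *)

Section Distance.
Local Open Scope nat_scope.
Variables (V : finType) (G : sgraph V).
Implicit Types u v x y : V.

Lemma gdist_le_path u p : path G u p -> (gdist G u (last u p) <= size p)%N.
Proof.
move=> Gp; have Cu : connect G u (last u p) by apply/connectP; exists p.
apply: (gdistP Cu).2; apply/existsP; exists (in_tuple p).
by rewrite /= Gp eqxx.
Qed.

Lemma gdist_path u v : connect G u v ->
  exists p, [/\ path G u p, last u p = v & size p = gdist G u v].
Proof.
case/gdistP=> /existsP[p /andP[Gp /eqP lp]] _.
by exists p; rewrite size_tuple.
Qed.

Lemma gdist_refl u : gdist G u u = 0%N.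
Proof. by apply/eqP; rewrite -leqn0 (@gdist_le_path u [::]). Qed.

Lemma gdist_edge u v : G u v -> (gdist G u v <= 1)%N.
Proof. by move=> uv; apply: (@gdist_le_path u [:: v]); rewrite /= uv. Qed.

Hypothesis connG : connected_graph G.

Lemma gdist_triangle u v w : (gdist G u w <= gdist G u v + gdist G v w)%N.
Proof.
have [p [Gp <- <-]] := gdist_path (connG u v).
have [q [Gq <- <-]] := gdist_path (connG (last u p) w).
by rewrite -size_cat -last_cat gdist_le_path // cat_path Gp.
Qed.

Lemma gdist_sym u v : gdist G u v = gdist G v u.
Proof.
suff le_sym a b : (gdist G a b <= gdist G b a)%N by apply/eqP; rewrite eqn_leq !le_sym.
have [p [Gp lp <-]] := gdist_path (connG b a).
have := @gdist_le_path a (rev (belast b p)).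
rewrite -lp rev_path (eq_path (e' := G)); last by move=> x y; exact: adj_sym.
move=> /(_ Gp); rewrite size_rev size_belast; congr (gdist _ _ _ <= _)%N.
by case: p {Gp lp} => //= c p; rewrite rev_cons last_rcons.
Qed.

Lemma gdist_eq0 u v : gdist G u v = 0%N -> u = v.
Proof.
have [p [_ <- <-]] := gdist_path (connG u v).
by move/eqP/nilP=> ->.
Qed.

(** Gives lower bounds on distances: it remains to choose a potential [phi] that grows by at most 1
    along each edge. *)
Lemma lipschitz_gdist (phi : V -> nat) u v :
  (forall x y, G x y -> phi y <= (phi x).+1)%N -> (phi v <= phi u + gdist G u v)%N.
Proof.
move=> lip; have [p [Gp <- <-]] := gdist_path (connG u v).
elim: p u Gp => [|x p IHp] u /=; first by rewrite addn0.
case/andP=> ux /IHp; have := lip _ _ ux; lia.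
Qed.
End Distance.

(* [B] is the side of [b] in the cut of a graph by its only crossing edge [b w]. *)
Record bridge (V : finType) (G : sgraph V) (B : {set V}) (b w : V) : Prop := Bridge {
  bridge_in : b \in B;
  bridge_out : w \notin B;
  bridge_adj : G b w;
  bridge_cross : forall x y, x \in B -> y \notin B -> G x y -> x = b /\ y = w }.

Section BridgeDistance.
Local Open Scope nat_scope.
Variables (V : finType) (G : sgraph V) (B : {set V}) (b w : V).
Hypotheses (connG : connected_graph G) (brB : bridge G B b w).

(** The upper bound goes through [w] and [b]. For the lower bound, the potential is the claimed
    value on [B] and the distance from [a] elsewhere; it is 1-Lipschitz even across the bridge. *)
Lemma gdist_bridge a v : a \notin B -> v \in B ->
  gdist G a v = (gdist G a w + (gdist G b v).+1)%N.
Proof.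
case: brB => bB wB bw cross aB vB; apply/eqP; rewrite eqn_leq; apply/andP; split.
  have := gdist_triangle connG a w v; have := gdist_triangle connG w b v.
  have : (gdist G w b <= 1)%N by apply: gdist_edge; rewrite adj_sym.
  lia.
pose phi x := if x \in B then (gdist G a w + (gdist G b x).+1)%N else gdist G a x.
have := @lipschitz_gdist _ G connG phi a v; rewrite /phi (negPf aB) vB gdist_refl.
apply=> x y xy.
have dxy := gdist_edge xy; have dyx : (gdist G y x <= 1)%N by apply: gdist_edge; rewrite adj_sym.
case: ifP => yB; case: ifP => xB.
- by have := gdist_triangle connG b x y; lia.
- have [yE xE] := cross y x yB (negbT xB) ltac:(by rewrite adj_sym).
  by rewrite yE xE gdist_refl; lia.
- have [xE yE] := cross x y xB (negbT yB) xy.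
  by rewrite yE; lia.
- by have := gdist_triangle connG a x y; lia.
Qed.

(* Collapsing the other side of a bridge onto its end is 1-Lipschitz. *)
Lemma gdist_bridge_side (H : sgraph V) :
  connected_graph H ->
  (forall x y, x \in B -> y \in B -> G x y = H x y) ->
  (forall x y, x \in B -> y \in B -> gdist H x y <= gdist G x y)%N.
Proof.
move=> connH GH x y xB yB; case: brB => bB _ _ cross.
pose r z := if z \in B then z else b.
have := @lipschitz_gdist _ G connG (fun z => gdist H x (r z)) x y.
rewrite /r xB yB gdist_refl add0n; apply=> u v uv.
suff : (gdist H (r u) (r v) <= 1)%N.
  by have := gdist_triangle connH x (r u) (r v); rewrite /r; lia.
rewrite /r; case: ifP => uB; case: ifP => vB; rewrite ?gdist_refl //.
- by apply: gdist_edge; rewrite -GH.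
- by have [-> _] := cross u v uB (negbT vB) uv; rewrite gdist_refl.
- have [-> _] := cross v u vB (negbT uB) ltac:(by rewrite adj_sym).
  by rewrite gdist_refl.
Qed.
End BridgeDistance.

Lemma bridgeC (V : finType) (G : sgraph V) (B : {set V}) (b w : V) :
  bridge G B b w -> bridge G (~: B) w b.
Proof.
case=> bB wB bw cross; split; rewrite ?inE ?bB // 1?adj_sym //.
move=> x y; rewrite !inE negbK => xB yB xy.
by have [-> ->] := cross y x yB xB ltac:(by rewrite adj_sym).
Qed.

Section TreeBridges.
Local Open Scope nat_scope.
Variables (V : finType) (G : sgraph V).
Hypothesis treeG : tree G.

(** [B] is the component of [b] once the edge is deleted. If it contained [w], a simple path from
    [b] to [w] avoiding the edge would be closed by it into a cycle. *)
Lemma tree_bridge b w : G b w -> exists B, bridge G B b w.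
Proof.
move=> bw; pose e := [rel x y | G x y && ((x, y) \notin [:: (b, w); (w, b)])].
have bNw : b != w by apply: contraTneq bw => ->; rewrite adj_irr.
have wB : ~~ connect e b w.
  apply/negP => /connectP[q]; case/shortenP=> p ep Up _ wE.
  have Gp : path G b p by apply: sub_path ep => x y /andP[].
  (* A path with a single edge would be the deleted edge itself. *)
  have szp : (2 < size (b :: p))%N.
    case: p {Up Gp} ep wE => [|x [|y p]] //=; first by move=> _ wb; rewrite wb eqxx in bNw.
    by move=> /andP[/andP[_ +] _] wx; rewrite -wx !inE eqxx.
  have /negP[] := treeG.2 _ szp.
  by rewrite /ucycleb Up /= rcons_path Gp -wE adj_sym bw.
exists [set x | connect e b x]; split; rewrite ?inE //.
move=> x y; rewrite !inE => bx by' xy.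
suff : (x, y) \in [:: (b, w); (w, b)].
  rewrite !inE !xpair_eqE => /orP[] /andP[/eqP xE /eqP yE] //.
  by rewrite -xE bx in wB.
apply: contraR by' => nxy; apply: connect_trans bx (connect1 _).
by rewrite /= xy.
Qed.
End TreeBridges.

(** * Moving a branch of a tree *)

Section BridgeCycle.
Local Open Scope nat_scope.
Variables (V : finType) (G : sgraph V) (B : {set V}) (b w : V).
Hypothesis brB : bridge G B b w.

(** Changing sides requires the bridge, hence a visit to [b]. *)
Lemma bridge_path_side x p :
  path G x p -> b \notin x :: p -> {in p, forall y, (y \in B) = (x \in B)}.
Proof.
case: brB => bB wB bw cross.
elim: p x => //= y p IHp x /andP[xy Gp]; rewrite !inE !negb_or => /and3P[bx bY bp].
have yx : (y \in B) = (x \in B).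
  apply/idP/idP; apply: contraLR => NB; apply/negP => inB.
    have [yb _] := cross y x inB NB ltac:(by rewrite adj_sym).
    by rewrite yb eqxx in bY.
  by have [xb _] := cross x y inB NB xy; rewrite xb eqxx in bx.
move=> z; rewrite inE => /predU1P[-> //|zp].
by rewrite (IHp y) // inE negb_or bY.
Qed.

(** A cycle that crosses the bridge must cross it again to return, and so would visit [w] twice. The
    proof rotates the cycle to start at [b]. *)
Lemma bridge_ucycle c : (2 < size c)%N -> ucycleb G c ->
  {subset c <= B} \/ {subset c <= ~: B}.
Proof.
case: (brB) => bB wB bw cross sz /andP[Gc Uc].
have [bc|bc] := boolP (b \in c); last first.
  case: c Gc bc {sz Uc} => [|x p] /= Gp bc; first by left.
  have side : {in x :: p, forall y, (y \in B) = (x \in B)}.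
    move=> y yp; apply: (bridge_path_side Gp); last by rewrite mem_rcons.
    by move: bc; rewrite !inE mem_rcons inE orbA orbb.
  have [xB|xB] := boolP (x \in B); [left|right] => y /side yx.
    by rewrite yx.
  by rewrite inE yx.
case/rot_to: bc => i p cE.
move: Gc Uc sz; rewrite -(rot_cycle i) -(rot_uniq i) -(size_rot i) cE /=.
case: p cE => // x p cE; rewrite -[rcons _ _]/(x :: rcons p b) /= rcons_path.
case/and3P=> bx Gp lb /andP[bp Up] sz.
have side := bridge_path_side Gp bp.
have sub (A : {set V}) : {subset b :: x :: p <= A} -> {subset c <= A}.
  by rewrite -cE => cA y yc; apply: cA; rewrite mem_rot.
have [xB|xB] := boolP (x \in B).
  left; apply: sub => y; rewrite !inE => /or3P[/eqP-> //|/eqP-> //|/side->].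
  exact: xB.
(* The vertices after and before [b] on the cycle are both outside [B], hence both equal to [w]. *)
have [_ xw] := cross b x bB xB bx.
have lB : last x p \notin B.
  by have := mem_last x p; rewrite inE => /predU1P[-> //|/side ->].
have [_ lw] := cross b _ bB lB ltac:(by rewrite adj_sym).
case: p {cE side sub Gp bp lB lb} sz Up lw => // y p _ /= /andP[xp _] lw.
by rewrite xw -lw mem_last in xp.
Qed.

Lemma bridge_crossE x y : x \in B -> y \notin B -> G x y = (x == b) && (y == w).
Proof.
case: brB => bB wB bw cross xB yB; apply/idP/andP => [xy|[/eqP-> /eqP->]] //.
by have [-> ->] := cross x y xB yB xy.
Qed.

(** Isolates the part of the degree that depends only on the graph inside [B], which moving the
    branch preserves. *)
Lemma bridge_degree_in x : x \in B ->
  degree G x = (#|[set y in B | G x y]| + (x == b))%N.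
Proof.
move=> xB; rewrite /degree -(cardsID B); congr (_ + _)%N.
  by apply: eq_card => y; rewrite !inE andbC.
have -> : [set v | G x v] :\: B = if x == b then [set w] else set0.
  apply/setP => y; rewrite !inE; have [yB|yB] := boolP (y \in B) => /=.
    by case: ifP => _; rewrite ?inE //; apply/esym; apply: contraTF yB => /eqP->; case: brB.
  by rewrite bridge_crossE //; case: eqP => _; rewrite inE.
by case: eqP; rewrite ?cards1 ?cards0.
Qed.
End BridgeCycle.

Section Regraft.
Local Open Scope nat_scope.
Variables (V : finType) (G : sgraph V) (b w w' : V).

Definition unordered_eq (a c x y : V) :=
  (x == a) && (y == c) || (x == c) && (y == a).

(** The tree [T_i] of the outline, with [w'] for [wi]. The conjunct [x != y] ensures irreflexivity
    even if [b = w'], so that [regraft] is defined without side conditions. *)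
Definition regraft_adj : rel V := fun x y =>
  (x != y) && (G x y && ~~ unordered_eq b w x y || unordered_eq b w' x y).

Lemma regraft_sym : symmetric regraft_adj.
Proof.
have usym a c x y : unordered_eq a c x y = unordered_eq a c y x.
  by rewrite /unordered_eq orbC andbC [(y == c) && _]andbC.
by move=> x y; rewrite /regraft_adj adj_sym eq_sym !(usym _ _ x).
Qed.

Lemma regraft_irr : irreflexive regraft_adj.
Proof. by move=> x; rewrite /regraft_adj eqxx. Qed.

Definition regraft := SGraph regraft_sym regraft_irr.

Variable B : {set V}.
Hypotheses (treeG : tree G) (brB : bridge G B b w).
Hypotheses (w'B : w' \notin B) (ww' : G w w').

Let bB : b \in B := bridge_in brB.
Let wB : w \notin B := bridge_out brB.
Let neq_side x y : x \in B -> y \notin B -> x != y.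
Proof. by move=> xB; apply: contraNneq => <-. Qed.
Let bNw' : b != w' := neq_side bB w'B.
Let wNw' : w != w'. Proof. by apply: contraTneq ww' => ->; rewrite adj_irr. Qed.

Lemma regraft_side_in x y : x \in B -> y \in B -> regraft x y = G x y.
Proof.
move=> xB yB; rewrite /= /regraft_adj /unordered_eq.
rewrite !(negPf (neq_side xB wB), negPf (neq_side yB wB)).
rewrite !(negPf (neq_side xB w'B), negPf (neq_side yB w'B)) /= !andbF /= orbF andbT.
by case: eqP => // ->; rewrite adj_irr.
Qed.

Lemma regraft_side_out x y : x \notin B -> y \notin B -> regraft x y = G x y.
Proof.
move=> xB yB; rewrite /= /regraft_adj /unordered_eq.
rewrite ![_ == b]eq_sym (negPf (neq_side bB xB)) (negPf (neq_side bB yB)).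
rewrite /= !andbF /= orbF andbT.
by case: eqP => // ->; rewrite adj_irr.
Qed.

Lemma regraft_bridge : bridge regraft B b w'.
Proof.
split=> //; first by rewrite /= /regraft_adj bNw' /unordered_eq !eqxx orbT.
move=> x y xB yB; rewrite /= /regraft_adj => /andP[_ /orP[/andP[xy]|]].
  by have [-> ->] := bridge_cross brB xB yB xy; rewrite /unordered_eq !eqxx.
rewrite /unordered_eq => /orP[] /andP[/eqP xE /eqP yE] //.
by rewrite xE (negPf w'B) in xB.
Qed.

(** The only lost edge, from [b] to [w], is replaced by the path [b], [w'], [w]. *)
Lemma regraft_connected : connected_graph regraft.
Proof.
move=> u v; apply: connect_sub (treeG.1 u v) => x y xy.
have bw : connect regraft b w.
  apply: connect_trans (connect1 (bridge_adj regraft_bridge)) (connect1 _).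
  by rewrite regraft_side_out // adj_sym.
have csym : connect_sym regraft by apply: sym_connect_sym; exact: adj_sym.
have [xB|xB] := boolP (x \in B); have [yB|yB] := boolP (y \in B).
- by apply: connect1; rewrite regraft_side_in.
- by have [-> ->] := bridge_cross brB xB yB xy.
- have [-> ->] := bridge_cross brB yB xB ltac:(by rewrite adj_sym).
  by rewrite csym.
- by apply: connect1; rewrite regraft_side_out.
Qed.

(** By [bridge_ucycle] a cycle stays on one side of the new bridge, where both graphs agree, so it
    is already a cycle of [G]. *)
Lemma regraft_tree : tree regraft.
Proof.
split; first exact: regraft_connected.
move=> c sz; apply/negP => Hc.
have /negP := treeG.2 c sz; apply; case/andP: (Hc) => cc Uc; rewrite /ucycleb Uc andbT.
case: (bridge_ucycle regraft_bridge sz Hc) => cB.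
  rewrite -(@eq_in_cycle _ (mem B) regraft) //; last exact/allP.
  by move=> x y; apply: regraft_side_in.
rewrite -(@eq_in_cycle _ (mem (~: B)) regraft) //; last exact/allP.
by move=> x y; rewrite !inE; apply: regraft_side_out.
Qed.

Let connG := treeG.1.
Let connH := regraft_connected.

(** [B] is bounded by a bridge in both graphs, so [gdist_bridge_side] applies in both directions. *)
Lemma gdist_regraft_in x y : x \in B -> y \in B -> gdist regraft x y = gdist G x y.
Proof.
move=> xB yB; apply/eqP; rewrite eqn_leq.
rewrite (gdist_bridge_side connG brB connH) //.
  rewrite (gdist_bridge_side connH regraft_bridge connG) //.
  by move=> *; rewrite regraft_side_in.
by move=> *; rewrite regraft_side_in.
Qed.

Lemma gdist_regraft_out x y : x \notin B -> y \notin B -> gdist regraft x y = gdist G x y.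
Proof.
move=> xB yB; apply/eqP; rewrite eqn_leq.
rewrite (gdist_bridge_side connG (bridgeC brB) connH) ?inE //.
  rewrite (gdist_bridge_side connH (bridgeC regraft_bridge) connG) ?inE //.
  by move=> u v; rewrite !inE => uB vB; rewrite regraft_side_out.
by move=> u v; rewrite !inE => uB vB; rewrite regraft_side_out.
Qed.

Lemma gdist_regraft_cross a v : a \notin B -> v \in B ->
  gdist regraft a v = (gdist G a w' + (gdist G b v).+1)%N.
Proof.
move=> aB vB; rewrite (gdist_bridge connH regraft_bridge) //.
by rewrite gdist_regraft_out // gdist_regraft_in.
Qed.

Lemma regraft_degree_in x : x \in B -> degree regraft x = degree G x.
Proof.
move=> xB; rewrite (bridge_degree_in regraft_bridge) // (bridge_degree_in brB) //.
congr (_ + _)%N; apply: eq_card => y; rewrite !inE.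
by have [yB|//] := boolP (y \in B); rewrite regraft_side_in.
Qed.

(** The neighbour [b] passes from [w] to [w']. Terms are added on both sides to avoid truncated
    subtraction. *)
Lemma regraft_degree_out x : x \notin B ->
  (degree regraft x + (x == w) = degree G x + (x == w'))%N.
Proof.
move=> xB; rewrite (bridge_degree_in (bridgeC regraft_bridge)) ?inE //.
rewrite (bridge_degree_in (bridgeC brB)) ?inE // -!addnA [((x == w') + _)%N]addnC.
congr (_ + _)%N; apply: eq_card => y; rewrite !inE.
by have [//|yB] := boolP (y \in B); rewrite regraft_side_out.
Qed.

(** The degree of [w] drops by one but stays at least 2, and that of [w'] only grows. Thus the new
    tree competes with [G] in the maximality hypothesis. *)
Lemma regraft_pendant : (2 < degree G w)%N -> (1 < degree G w')%N ->
  pendant regraft = pendant G.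
Proof.
move=> dw dw'; apply/setP => x; rewrite !inE.
have [xB|xB] := boolP (x \in B); first by rewrite regraft_degree_in.
have := regraft_degree_out xB.
have [->|_] := eqVneq x w; first by rewrite (negPf wNw'); lia.
by have [->|_] := eqVneq x w'; lia.
Qed.
End Regraft.

(** * Effect of moving a branch on the spectral radius *)

Section NeighborDistance.
Variables (V : finType) (G : sgraph V).
Hypothesis treeG : tree G.

(** The edge is a bridge, and [a] lies on the side of exactly one of its ends. *)
Lemma gdist_neighbor a w v : G w v ->
  gdist G a v = (gdist G a w).+1 \/ gdist G a w = (gdist G a v).+1.
Proof.
move=> wv; have [B brB] := tree_bridge treeG (etrans (adj_sym G v w) wv).
have gsym := gdist_sym treeG.1.
have [aB|aB] := boolP (a \in B); [right|left].
  by rewrite gsym (gdist_bridge treeG.1 brB (bridge_out brB) aB) gdist_refl gsym.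
by rewrite (gdist_bridge treeG.1 brB aB (bridge_in brB)) gdist_refl addn1.
Qed.

(** By [gdist_neighbor] the inequality fails only if both neighbours are nearer to [a] than [w]. The
    bridge between [w2] and [w] excludes this: from its [w2] side [a] reaches [w1] through [w], and
    from the other side it reaches [w2] through [w]. *)
Lemma gdist_neighbor_convex a w w1 w2 : G w w1 -> G w w2 -> w1 != w2 ->
  ((gdist G a w).*2 <= gdist G a w1 + gdist G a w2)%N.
Proof.
move=> ww1 ww2 w12; have [B brB] := tree_bridge treeG (etrans (adj_sym G w2 w) ww2).
have gsym := gdist_sym treeG.1.
suff : ~ (gdist G a w = (gdist G a w1).+1 /\ gdist G a w = (gdist G a w2).+1).
  by case: (gdist_neighbor a ww1); case: (gdist_neighbor a ww2); lia.
case=> d1 d2.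
have w1B : w1 \notin B.
  apply/negP => w1B; have [w1E _] := bridge_cross brB w1B (bridge_out brB) (etrans (adj_sym G w1 w) ww1).
  by rewrite w1E eqxx in w12.
have [aB|aB] := boolP (a \in B).
  have := gdist_bridge treeG.1 brB w1B aB; rewrite !(gsym _ a).
  by lia.
have := gdist_bridge treeG.1 brB aB (bridge_in brB); lia.
Qed.
End NeighborDistance.

(** * The quadratic form of the distance Laplacian *)

Section LaplacianForm.
Variables (R : realType) (n : nat) (G : sgraph 'I_n).
Hypothesis connG : connected_graph G.
Local Notation L := (distance_laplacian R G).
Implicit Types x y : 'rV[R]_n.

Lemma distance_laplacian_sym : L^T = L.
Proof.
rewrite /distance_laplacian linearB /= tr_diag_mx; congr (_ - _).
by apply/matrixP => i j; rewrite !mxE gdist_sym.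
Qed.

Lemma mul_distance_laplacian x j :
  (x *m L) 0 j = \sum_i (gdist G i j)%:R * (x 0 j - x 0 i).
Proof.
rewrite mulmxBr mul_mx_diag !mxE /transmission natr_sum mulr_sumr -sumrB.
by apply: eq_bigr => i _; rewrite !mxE gdist_sym //; ring.
Qed.

(** The form is added to its copy with [i] and [j] exchanged. The factor 2 reflects a sum over
    ordered pairs. *)
Lemma qform_distance_laplacian x :
  2 * qform L x = \sum_j \sum_i (gdist G i j)%:R * (x 0 j - x 0 i) ^+ 2.
Proof.
have qE : qform L x = \sum_j \sum_i (gdist G i j)%:R * (x 0 j - x 0 i) * x 0 j.
  rewrite /qform mxE; apply: eq_bigr => j _.
  by rewrite mul_distance_laplacian mulr_suml mxE.
rewrite mulr2n mulrDl mul1r {1}qE exchange_big qE -big_split; apply: eq_bigr => j _ /=.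
rewrite -big_split; apply: eq_bigr => i _ /=.
by rewrite (gdist_sym connG j i); ring.
Qed.

Hypothesis n_gt0 : (0 < n)%N.

Lemma rhoL_rayleigh x : qform L x <= rhoL R G * \sum_i x 0 i ^+ 2.
Proof.
have [m eig_m mP] := symmetric_max_eigenvalue n_gt0 distance_laplacian_sym.
apply: le_trans (mP x) _; rewrite ler_wpM2r ?sumr_ge0 // => [i _|]; first exact: sqr_ge0.
by have [_] := rhoL_largest R G n_gt0; apply.
Qed.

(** The form of [a%:M - L] is nonnegative and vanishes at [x]. The bound [a] need not be [rhoL R G]:
    the lemma is applied to a regrafted tree with the [rhoL] of the original one. *)
Lemma rayleigh_eigenvector a x : rhoL R G <= a ->
  qform L x = a * \sum_i x 0 i ^+ 2 -> x *m L = a *: x.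
Proof.
move=> rho_a qx; apply/eqP; rewrite eq_sym -subr_eq0 -mul_mx_scalar -mulmxBr; apply/eqP/psd_qform_eq0.
- by rewrite linearB /= tr_scalar_mx distance_laplacian_sym.
- move=> y; rewrite qformB qform_scalar subr_ge0 (le_trans (rhoL_rayleigh y)) //.
  by rewrite ler_wpM2r // sumr_ge0 // => i _; exact: sqr_ge0.
- by rewrite qformB qform_scalar qx subrr.
Qed.
End LaplacianForm.

Section Graft.
Variables (R : realType) (n : nat) (G : sgraph 'I_n) (b w w' : 'I_n) (B : {set 'I_n}).
Hypotheses (treeG : tree G) (brB : bridge G B b w) (w'B : w' \notin B) (ww' : G w w').
Local Notation H := (regraft G b w w').

(** For [a] outside [B], the change of the distance from [a] to a vertex of [B]; it is the same for
    all of [B]. *)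
Let delta a : R := (gdist G a w')%:R - (gdist G a w)%:R.

Let gdistH i j : (gdist H i j)%:R = (gdist G i j)%:R +
  (if i \in B then if j \in B then 0 else delta j
   else if j \in B then delta i else 0) :> R.
Proof.
have treeH := regraft_tree treeG brB w'B ww'.
have cross a v : a \notin B -> v \in B -> (gdist H a v)%:R = (gdist G a v)%:R + delta a :> R.
  move=> aB vB; rewrite (gdist_regraft_cross treeG brB w'B ww' aB vB).
  by rewrite (gdist_bridge treeG.1 brB aB vB) /delta !natrD; ring.
case: ifP => iB; case: ifP => jB.
- by rewrite (gdist_regraft_in treeG brB) // addr0.
- by rewrite (gdist_sym treeH.1) (gdist_sym treeG.1) cross ?jB.
- by rewrite cross ?iB.
- by rewrite (gdist_regraft_out treeG brB) ?iB ?jB // addr0.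
Qed.

Let gain (x : 'rV[R]_n) := \sum_(a | a \notin B) delta a * \sum_(v in B) (x 0 a - x 0 v) ^+ 2.

Lemma qform_regraft x :
  qform (distance_laplacian R H) x = qform (distance_laplacian R G) x + gain x.
Proof.
have treeH := regraft_tree treeG brB w'B ww'.
suff : 2 * qform (distance_laplacian R H) x = 2 * qform (distance_laplacian R G) x + 2 * gain x by lra.
rewrite !qform_distance_laplacian //; [|exact: treeG.1|exact: treeH.1].
have gainE : gain x = \sum_(j | j \notin B) \sum_(i in B) delta j * (x 0 j - x 0 i) ^+ 2.
  by apply: eq_bigr => j _; rewrite mulr_sumr.
(* A pair across the cut occurs in both orders in the double sum; one copy of [gain x] accounts for
   each order. *)
rewrite (_ : 2 * gain x = gain x + gain x); last by ring.
rewrite {1}gainE gainE.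
rewrite [X in _ = _ + (_ + X)]exchange_big /=.
rewrite [X in _ = _ + (X + _)]big_mkcond [X in _ = _ + (_ + X)]big_mkcond /= -!big_split.
apply: eq_bigr => j _ /=.
under eq_bigr do rewrite gdistH mulrDl.
rewrite big_split /=; congr (_ + _).
have [jB|jB] := boolP (j \in B); rewrite /= ?addr0 ?add0r [RHS]big_mkcond /=; apply: eq_bigr => i _.
  by case: (i \in B); rewrite ?mul0r //=; ring.
by case: (i \in B); rewrite ?mul0r.
Qed.

Lemma regraft_gain (x : 'rV[R]_n) : rhoL R H <= rhoL R G ->
  x *m distance_laplacian R G = rhoL R G *: x ->
  gain x <= 0 /\
  (gain x = 0 -> forall a, a \notin B -> \sum_(v in B) (x 0 a - x 0 v) = 0).
Proof.
move=> leHG xG; have treeH := regraft_tree treeG brB w'B ww'.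
have n_gt0 : (0 < n)%N by case: n w => // -[].
have qG : qform (distance_laplacian R G) x = rhoL R G * \sum_i x 0 i ^+ 2.
  by rewrite /qform xG -scalemxAl !mxE; congr (_ * _); apply: eq_bigr => i _; rewrite mxE.
have s_ge0 : 0 <= \sum_i x 0 i ^+ 2 by rewrite sumr_ge0 // => i _; exact: sqr_ge0.
split=> [|gain0 a aB].
  have := rhoL_rayleigh treeH.1 n_gt0 x; rewrite qform_regraft qG.
  by have := ler_wpM2r s_ge0 leHG; lra.
(* With zero gain, [x] reaches in [H] the upper bound [rhoL R G]. *)
have xH : x *m distance_laplacian R H = rhoL R G *: x.
  by apply: rayleigh_eigenvector leHG _; rewrite ?qform_regraft ?gain0 ?addr0 //; exact: treeH.1.
have /= := congr1 (fun y : 'rV_n => y 0 a) (etrans xH (esym xG)).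
rewrite !mul_distance_laplacian; [|exact: treeG.1|exact: treeH.1] => sumHG.
have : delta a * \sum_(v in B) (x 0 a - x 0 v) = 0.
  move/eqP: sumHG; rewrite -subr_eq0 -sumrB => /eqP sum0.
  rewrite -[RHS]sum0 mulr_sumr big_mkcond; apply: eq_bigr => i _.
  by rewrite gdistH (negPf aB); case: ifP => _; ring.
move/eqP; rewrite mulf_eq0 => /orP[|/eqP//].
(* [delta a] is 1 or -1, since [w] and [w'] are adjacent. *)
rewrite subr_eq0 eqr_nat => /eqP; have := gdist_neighbor treeG a ww'; lia.
Qed.
End Graft.

(** * Branching in a tree of maximal spectral radius *)

Section Maximal.
Variables (R : realType) (n : nat) (G : sgraph 'I_n).
Hypotheses (treeG : tree G)
  (maxG : forall H : sgraph 'I_n, tree H -> pendant H = pendant G -> rhoL R H <= rhoL R G).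

(** The form at the coordinate vector of [u] is positive: the pair [u], [v] already contributes
    their distance. *)
Lemma rhoL_gt0 (u v : 'I_n) : u != v -> 0 < rhoL R G.
Proof.
move=> uv; have n_gt0 : (0 < n)%N by case: n u {uv} => // -[].
pose y : 'rV[R]_n := delta_mx 0 u.
have y1 : \sum_i y 0 i ^+ 2 = 1.
  rewrite (bigD1 u) //= big1 => [|i /negPf iu]; first by rewrite mxE !eqxx expr1n addr0.
  by rewrite mxE iu andbF expr0n.
have := rhoL_rayleigh treeG.1 n_gt0 y; rewrite y1 mulr1.
apply: lt_le_trans; rewrite -(pmulr_rgt0 _ (ltr0Sn R 1)).
rewrite qform_distance_laplacian; last exact: treeG.1.
have term_ge0 i j : 0 <= (gdist G i j)%:R * (y 0 j - y 0 i) ^+ 2.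
  by rewrite mulr_ge0 ?sqr_ge0.
rewrite (bigD1 u) //= ltr_wpDr ?sumr_ge0 // => [i _|]; first by rewrite sumr_ge0.
rewrite (bigD1 v) //=; rewrite ltr_wpDr ?sumr_ge0 // !mxE !eqxx [v == u]eq_sym (negPf uv).
rewrite subr0 expr1n mulr1.
rewrite ltr0n lt0n; apply: contra_neq uv => /(gdist_eq0 treeG.1) //.
Qed.

(** The branch at [b] is moved to [w1] and to [w2]; [b] itself may be pendant. The degree hypotheses
    keep the set of pendant vertices unchanged. *)
Lemma maximal_branching w b w1 w2 :
  G w b -> G w w1 -> G w w2 -> b != w1 -> b != w2 -> w1 != w2 ->
  (1 < degree G w1)%N -> (1 < degree G w2)%N -> False.
Proof.
move=> wb ww1 ww2 b1 b2 w12 d1 d2.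
have n_gt0 : (0 < n)%N by case: n w {wb ww1 ww2} => // -[].
have dw : (2 < degree G w)%N.
  have <- : #|b |: [set w1; w2]| = 3%N by rewrite cardsU1 !inE negb_or b1 b2 cards2 w12.
  by apply/subset_leq_card/subsetP => y; rewrite !inE => /or3P[] /eqP->.
have [B brB] := tree_bridge treeG (etrans (adj_sym G b w) wb).
have notB v : G w v -> b != v -> v \notin B.
  move=> wv; apply: contra_neqN => vB.
  by have [] := bridge_cross brB vB (bridge_out brB) (etrans (adj_sym G v w) wv).
have [x xG x_nz] : exists2 x : 'rV_n, x *m distance_laplacian R G = rhoL R G *: x & x != 0.
  by have [/eigenvalueP] := rhoL_largest R G n_gt0.
have gain v : G w v -> b != v -> (1 < degree G v)%N ->
  _ := fun wv bv dv => regraft_gain treeG brB (notB v wv bv) wv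
    (maxG (regraft_tree treeG brB (notB v wv bv) wv)
      (regraft_pendant brB (notB v wv bv) wv dw dv)) xG.
have [le1 eq1] := gain w1 ww1 b1 d1; have [le2 _] := gain w2 ww2 b2 d2.
pose g a := \sum_(v in B) (x 0 a - x 0 v) ^+ 2.
have g_ge0 a : 0 <= g a by rewrite sumr_ge0 // => v _; exact: sqr_ge0.
pose d a v : R := (gdist G a v)%:R.
have sumE : \sum_(a | a \notin B) (d a w1 - d a w) * g a +
    \sum_(a | a \notin B) (d a w2 - d a w) * g a =
    \sum_(a | a \notin B) (d a w1 + d a w2 - 2 * d a w) * g a.
  by rewrite -big_split; apply: eq_bigr => a _ /=; ring.
have term_ge0 a : a \notin B -> 0 <= (d a w1 + d a w2 - 2 * d a w) * g a.
  move=> _; rewrite mulr_ge0 // subr_ge0 -natrM -natrD ler_nat mul2n.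
  exact: gdist_neighbor_convex.
have sum_ge0 := sumr_ge0 _ term_ge0.
(* The sum is nonnegative by convexity of distances, and nonpositive as the total of the two
   gains. *)
have sum0 : \sum_(a | a \notin B) (d a w1 + d a w2 - 2 * d a w) * g a = 0.
  by apply/eqP; rewrite eq_le sum_ge0 andbT -sumE -[leRHS]addr0 lerD.
(* At [a = w] the coefficient is the sum of the distances to [w1] and [w2], which is not zero. *)
have gw0 : g w = 0.
  have /eqP := psumr_eq0P term_ge0 sum0 (bridge_out brB).
  rewrite /d gdist_refl mulr0 subr0 -natrD mulf_eq0 pnatr_eq0 addn_eq0.
  case/orP => [/andP[/eqP/(gdist_eq0 treeG.1) w1E _]|/eqP//].
  by rewrite w1E adj_irr in ww1.
have xB v : v \in B -> x 0 v = x 0 w.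
  move=> vB; have /eqP := psumr_eq0P (fun v _ => sqr_ge0 (x 0 w - x 0 v)) gw0 vB.
  by rewrite sqrf_eq0 subr_eq0 => /eqP.
(* Two nonpositive gains with sum zero both vanish; the equality case of [regraft_gain] is needed
   for [w1] only. *)
have sum1 : \sum_(a | a \notin B) (d a w1 - d a w) * g a = 0.
  by apply/eqP; rewrite eq_le le1 /=; move: sumE le2; rewrite sum0 /d /g; lra.
have xc a : x 0 a = x 0 w.
  have [/xB //|aB] := boolP (a \in B).
  move/eqP: (eq1 sum1 a aB).
  rewrite (eq_bigr (fun=> x 0 a - x 0 w)) => [|v /xB -> //].
  rewrite sumr_const mulrn_eq0 cards_eq0 subr_eq0 => /orP[/eqP B0|/eqP//].
  by have := bridge_in brB; rewrite B0 inE.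
have xL0 : x *m distance_laplacian R G = 0.
  apply/rowP => j; rewrite mul_distance_laplacian; last exact: treeG.1.
  by rewrite mxE big1 // => i _; rewrite !xc subrr mulr0.
move: xG; rewrite xL0 => /esym/eqP; rewrite scaler_eq0 (negPf x_nz) orbF.
have wNb : w != b by apply: contraTneq wb => ->; rewrite adj_irr.
by rewrite gt_eqF // (rhoL_gt0 wNb).
Qed.
End Maximal.

(** * Double brooms *)

Section Broom.
Local Open Scope nat_scope.
Variables (V : finType) (G : sgraph V) (n k : nat).
Hypotheses (treeG : tree G) (cardV : #|V| = n) (cardP : #|pendant G| = k).
Hypothesis kn : (2 <= k <= n - 2)%N.
Local Notation inner := (~: pendant G).
Hypothesis no_branching : forall w b w1 w2,
  G w b -> G w w1 -> G w w2 -> b != w1 -> b != w2 -> w1 != w2 ->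
  (1 < degree G w1)%N -> (1 < degree G w2)%N -> False.

(** Connectedness excludes degree 0, as there is a second vertex. *)
Lemma inner_degree x : x \in inner -> (1 < degree G x)%N.
Proof.
rewrite !inE => dx; rewrite ltn_neqAle eq_sym dx lt0n /=.
have [y yx] : exists y, y != x.
  have /card_gt0P[y] : (0 < #|[set~ x]|)%N by rewrite cardsC1; lia.
  by rewrite !inE; exists y.
have /connectP[[|z p] /= Gp yE] := treeG.1 x y; first by rewrite yE eqxx in yx.
by apply/eqP => /eqP; rewrite cards_eq0 => /eqP/setP/(_ z); rewrite !inE; case/andP: Gp => ->.
Qed.

Lemma pendant_adj v x z : v \in pendant G -> G v x -> G v z = (z == x).
Proof.
rewrite inE => /cards1P[y /setP Ny] vx.
by have := Ny z; have := Ny x; rewrite !inE vx => /esym/eqP ->.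
Qed.

Lemma inner_path_neighbors w w1 w2 y : G w w1 -> G w w2 -> w1 != w2 ->
  w1 \in inner -> w2 \in inner -> G w y -> (y == w1) || (y == w2).
Proof.
move=> ww1 ww2 w12 /inner_degree d1 /inner_degree d2 wy.
apply: contraT; rewrite negb_or => /andP[y1 y2].
by case: (no_branching wy ww1 ww2).
Qed.

Definition inner_path (s : seq V) := [&& uniq s, sorted G s & all (mem inner) s].

Lemma longest_inner_path :
  exists s, [/\ inner_path s, s != [::] & forall t, inner_path t -> (size t <= size s)%N].
Proof.
pose P m := [exists t : m.-tuple V, inner_path t].
have exP : exists m, P m by exists 0; apply/existsP; exists [tuple].
have maxP m : P m -> (m <= #|V|)%N.
  by case/existsP=> t /and3P[/card_uniqP + _ _]; rewrite size_tuple => <-; exact: max_card.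
case: (ex_maxnP exP maxP) => m /existsP[s sP] m_max.
have s_max t : inner_path t -> (size t <= size s)%N.
  move=> tP; rewrite size_tuple; apply: m_max; apply/existsP.
  by exists (in_tuple t).
exists s; split=> //; rewrite -size_eq0 -lt0n.
have /card_gt0P[x xI] : (0 < #|inner|)%N by rewrite cardsCs setCK; lia.
by apply: (s_max [:: x]); rewrite /inner_path /= xI.
Qed.

(** * The spine: a longest path of non-pendant vertices *)

Section Spine.
Variables (x0 : V) (s : seq V).
Hypotheses (s_inner : inner_path s) (s_neq0 : s != [::]).
Hypothesis s_max : forall t, inner_path t -> (size t <= size s)%N.
Local Notation "'s_' i" := (nth x0 s i) (at level 8, i at level 2, format "s_ i").

Let s_uniq : uniq s. Proof. by case/and3P: s_inner. Qed.
Let s_sorted : sorted G s. Proof. by case/and3P: s_inner. Qed.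
Let s_sub : {subset s <= inner}. Proof. by case/and3P: s_inner => _ _ /allP. Qed.

Lemma spineP x : x \in s -> exists2 i, (i < size s)%N & s_ i = x.
Proof. by move/(nthP x0). Qed.

Lemma spine_eq i j : (i < size s)%N -> (j < size s)%N -> (s_ i == s_ j) = (i == j).
Proof. by move=> lt_i lt_j; rewrite nth_uniq. Qed.

Lemma spine_step i : (i.+1 < size s)%N -> G (s_ i) (s_ i.+1).
Proof. exact/(sortedP x0). Qed.

Lemma spine_inside i y : (i.+2 < size s)%N -> G (s_ i.+1) y ->
  (y == s_ i) || (y == s_ i.+2).
Proof.
move=> lt_i; have lt_i1 := ltnW lt_i; have lt_i0 := ltnW lt_i1.
apply: inner_path_neighbors; rewrite ?spine_step 1?adj_sym ?spine_step //.
- by rewrite spine_eq //; lia.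
- by apply/s_sub/mem_nth.
- by apply/s_sub/mem_nth.
Qed.

(** At an end of [s], a new inner neighbour would extend the path, against [s_max]; elsewhere
    [spine_inside] leaves no room for one. *)
Lemma spine_closed x y : x \in s -> G x y -> y \in inner -> y \in s.
Proof.
move=> xs xy yI; apply: contraT => yNs.
have [u_s srt] := (s_uniq, s_sorted); have all_s : all (mem inner) s by exact/allP.
have long t : inner_path t -> size t = (size s).+1 -> false by move=> /[swap] st /s_max; rewrite st ltnn.
have [i lt_i xE] := spineP xs.
case: i => [|i] in lt_i xE.
  apply: (long (y :: s)) => //; rewrite /inner_path /= yNs u_s all_s yI.
  by case: s xE srt {lt_i} => //= z p -> ->; rewrite adj_sym xy.
have [lt_i1|ge_i1] := ltnP i.+2 (size s).
  rewrite -xE in xy; have := spine_inside lt_i1 xy.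
  by case/orP=> /eqP yE; rewrite yE mem_nth // in yNs; exact: ltnW.
apply: (long (rcons s y)); last by rewrite size_rcons.
rewrite /inner_path rcons_uniq yNs u_s all_rcons /= yI all_s andbT.
have lE : last x0 s = x by rewrite -nth_last -xE; congr nth; lia.
by case: s srt lE {lt_i xE ge_i1} => //= z p zp lE; rewrite rcons_path zp lE xy.
Qed.

(** The property propagates along a path from a spine vertex to [v]. *)
Lemma spine_or_leaf v :
  v \in s \/ v \in pendant G /\ exists2 x, x \in s & G v x.
Proof.
have [z zs] : exists z, z \in s by case: s s_neq0 => // z p _; exists z; rewrite inE eqxx.
have /connectP[p] := treeG.1 z v.
have : z \in s \/ z \in pendant G /\ exists2 x, x \in s & G z x by left.
elim: p z {zs} => [|y p IHp] z /= Qz; first by move=> _ ->.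
case/andP=> zy; apply: IHp; case: Qz => [zs|[zP [x xs zx]]].
  have [yP|yI] := boolP (y \in pendant G).
    by right; split=> //; exists z; rewrite // adj_sym.
  by left; apply: spine_closed zs zy _; rewrite inE.
by left; move: zy; rewrite (pendant_adj _ zP zx) => /eqP->.
Qed.

Lemma mem_spine : s =i inner.
Proof.
move=> v; apply/idP/idP => [/s_sub //|]; rewrite inE.
by case: (spine_or_leaf v) => [//|[->]].
Qed.

Lemma size_spine : size s = (n - k)%N.
Proof. by rewrite -(card_uniqP s_uniq) (eq_card mem_spine) cardsCs setCK cardV cardP. Qed.

Let size_gt1 : (1 < size s)%N. Proof. by rewrite size_spine; lia. Qed.

(** A chord with an end inside the spine contradicts [spine_inside]; a chord between the two
    extremities closes [s] into a cycle. *)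
Lemma spine_adj_lt i j : (i < j < size s)%N -> G (s_ i) (s_ j) -> i.+1 = j.
Proof.
move=> /andP[ij lt_j] Gij; apply/eqP; apply: contraT => ij1.
have lt_i := ltn_trans ij lt_j.
have [j_last|j_in] := eqVneq j.+1 (size s); last first.
  case: j => // j in ij lt_j Gij ij1 j_in *.
  have := @spine_inside j (s_ i) ltac:(lia) ltac:(by rewrite adj_sym).
  by rewrite !spine_eq; [lia|lia|lia|lia|lia].
case: i => [|i] in ij Gij ij1 lt_i *; last first.
  have := @spine_inside i (s_ j) ltac:(lia) Gij.
  by rewrite !spine_eq; [lia|lia|lia|lia|lia].
have /negP[] := treeG.2 s ltac:(lia).
rewrite /ucycleb s_uniq andbT; have := s_sorted.
have lE : last x0 s = s_ j by rewrite -nth_last; congr nth; lia.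
by case: s lE Gij {lt_i} => //= z p <- zl zp; rewrite rcons_path zp adj_sym.
Qed.

Lemma spine_adj i j : (i < size s)%N -> (j < size s)%N ->
  G (s_ i) (s_ j) = (i.+1 == j) || (j.+1 == i).
Proof.
move=> lt_i lt_j; apply/idP/idP => [Gij|/orP[]/eqP E].
- case: (ltngtP i j) => ij.
  + by rewrite (@spine_adj_lt i j) ?ij ?eqxx.
  + by rewrite (@spine_adj_lt j i) ?ij ?eqxx ?orbT // adj_sym.
  + by rewrite ij adj_irr in Gij.
- by rewrite -E in lt_j *; exact: spine_step.
- by rewrite -E in lt_i *; rewrite adj_sym; exact: spine_step.
Qed.

Definition leaves_at x := [set v in pendant G | G x v].

Lemma mem_leaves_at x v : (v \in leaves_at x) = (v \in pendant G) && G x v.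
Proof. by rewrite {1}/leaves_at in_set. Qed.

(** The vertex [s_ i] has degree at least 2 and at most one neighbour on the spine, so it has
    another neighbour, pendant by [spine_or_leaf]. The index [j] lets one statement serve both
    ends. *)
Lemma leaves_at_end i j : (i < size s)%N -> (j < size s)%N ->
  (forall y, y \in s -> G (s_ i) y -> y = s_ j) -> (0 < #|leaves_at (s_ i)|)%N.
Proof.
move=> lt_i lt_j only.
have := inner_degree (s_sub (mem_nth x0 lt_i)).
rewrite /degree (cardsD1 (s_ j)) => dgt1.
have /card_gt0P[y] : (0 < #|[set v | G (s_ i) v] :\ s_ j|)%N.
  by move: dgt1; case: (_ \in _) => /=; lia.
rewrite !inE => /andP[yj iy].
apply/card_gt0P; exists y; rewrite inE iy andbT.
case: (spine_or_leaf y) => [ys|[] //].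
by rewrite (only y ys iy) eqxx in yj.
Qed.

Let l := size s.

(** Every pendant vertex hangs from the spine, and not from its interior, where all neighbours are
    inner. *)
Lemma pendant_leaves : pendant G = leaves_at (s_ 0) :|: leaves_at (s_ l.-1).
Proof.
apply/setP => v; rewrite in_setU.
apply/idP/orP => [vP|[]]; [|by rewrite inE => /andP[]..].
suff : G (s_ 0) v \/ G (s_ l.-1) v by case=> ?; [left|right]; rewrite inE vP.
case: (spine_or_leaf v) => [/s_sub|[_ [x /spineP[i lt_i <-]]]]; first by rewrite inE vP.
rewrite adj_sym => iv; case: i => [|i] in lt_i iv *; first by left.
have [lt_i1|ge_i1] := ltnP i.+2 (size s); last first.
  by right; have -> : l.-1 = i.+1 by rewrite /l; lia.
have vI : v \in inner.
  by case/orP: (spine_inside lt_i1 iv) => /eqP->; apply/s_sub/(mem_nth x0) => //; exact: ltnW.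
by rewrite inE vP in vI.
Qed.

(** The evident map [g] from the broom to [G] preserves adjacency and is injective; counting makes
    it bijective, and its inverse is the isomorphism. *)
Lemma double_broom_iso :
  graph_iso G (double_broom n k #|leaves_at (s_ 0)| #|leaves_at (s_ l.-1)|).
Proof.
set A := leaves_at (s_ 0); set D := leaves_at (s_ l.-1).
have ltl i : (i < n - k -> i < size s)%N by rewrite size_spine.
pose g (z : 'I_(n - k) + 'I_#|A| + 'I_#|D|) : V := match z with
  | inl (inl i) => s_ i
  | inl (inr a) => enum_val a
  | inr d => enum_val d
  end.
have AP (a : 'I_#|A|) : enum_val a \in pendant G /\ G (enum_val a) (s_ 0).
  by have := enum_valP a; rewrite mem_leaves_at adj_sym => /andP.
have DP (d : 'I_#|D|) : enum_val d \in pendant G /\ G (enum_val d) (s_ l.-1).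
  by have := enum_valP d; rewrite mem_leaves_at adj_sym => /andP.
have sNP i v : (i < n - k)%N -> v \in pendant G -> s_ i != v.
  by move=> /ltl lt_i; apply: contraTneq => <-; have := s_sub (mem_nth x0 lt_i); rewrite inE.
have l_gt1 : (1 < l)%N by [].
have lE : l = (n - k)%N by exact: size_spine.
(* A pendant vertex has one neighbour, and the two ends of the spine differ because [1 < l]. *)
have ADdis (a : 'I_#|A|) (d : 'I_#|D|) : enum_val a != enum_val d :> V.
  have [aP a0] := AP a; have [_ dl] := DP d; apply/eqP => ad.
  by move: dl; rewrite -ad (pendant_adj _ aP a0) spine_eq // /l; lia.
have gadj z t : G (g z) (g t) = double_broom n k #|A| #|D| z t.
  have sA (i : 'I_(n - k)) a : G (enum_val (A := mem A) a) (s_ i) = (i == 0 :> nat).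
    have [aP a0] := AP a; rewrite (pendant_adj _ aP a0) spine_eq // ?ltl //; lia.
  have sD (i : 'I_(n - k)) d : G (enum_val (A := mem D) d) (s_ i) = (i.+1 == (n - k)%N).
    have [dP d0] := DP d; rewrite (pendant_adj _ dP d0) spine_eq // ?ltl // /l; lia.
  case: z t => [[i|a]|d] [[j|a']|d'] /=.
  - by rewrite spine_adj ?ltl.
  - by rewrite adj_sym sA.
  - by rewrite adj_sym sD.
  - by rewrite sA.
  - have [aP a0] := AP a; have [aP' _] := AP a'.
    by rewrite (pendant_adj _ aP a0) eq_sym; apply/negbTE/sNP => //; lia.
  - have [aP a0] := AP a; have [dP _] := DP d'.
    by rewrite (pendant_adj _ aP a0) eq_sym; apply/negbTE/sNP => //; lia.
  - by rewrite sD.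
  - have [dP d0] := DP d; have [aP _] := AP a'.
    by rewrite (pendant_adj _ dP d0) eq_sym; apply/negbTE/sNP => //; lia.
  - have [dP d0] := DP d; have [aP _] := DP d'.
    by rewrite (pendant_adj _ dP d0) eq_sym; apply/negbTE/sNP => //; lia.
have ginj : injective g.
  move=> [[i|a]|d] [[j|a']|d'] /= /eqP.
  - by rewrite spine_eq ?ltl // => /eqP/val_inj->.
  - by have [aP _] := AP a'; rewrite (negPf (sNP _ _ _ aP)).
  - by have [dP _] := DP d'; rewrite (negPf (sNP _ _ _ dP)).
  - by have [aP _] := AP a; rewrite eq_sym (negPf (sNP _ _ _ aP)).
  - by move/eqP/enum_val_inj->.
  - by rewrite (negPf (ADdis _ _)).
  - by have [dP _] := DP d; rewrite eq_sym (negPf (sNP _ _ _ dP)).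
  - by rewrite eq_sym (negPf (ADdis _ _)).
  - by move/eqP/enum_val_inj->.
(* The leaves at the two ends cover the [k] pendant vertices. *)
have gcard : (#|V| <= #|{: 'I_(n - k) + 'I_#|A| + 'I_#|D|}|)%N.
  rewrite !card_sum !card_ord cardV.
  have : (k <= #|A| + #|D|)%N by rewrite -cardP pendant_leaves leq_card_setU.
  by lia.
have [h gK hK] := inj_card_bij ginj gcard.
exists h; first by exists g.
by move=> u v; rewrite -gadj !hK.
Qed.
End Spine.

Lemma exists_double_broom_iso : exists t1 t2,
  [/\ (1 <= t1)%N, (1 <= t2)%N, (t1 + t2 = k)%N & graph_iso G (double_broom n k t1 t2)].
Proof.
have [s [s_inner s_neq0 s_max]] := longest_inner_path.
have x0 : V by case: s s_neq0 {s_inner s_max}.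
have sz := size_spine x0 s_inner s_neq0 s_max.
exists #|leaves_at (nth x0 s 0)|, #|leaves_at (nth x0 s (size s).-1)|; split.
- apply: (leaves_at_end s_inner s_neq0 s_max (j := 1)); rewrite ?sz; [lia|lia|].
  move=> y /(spineP x0)[j lt_j <-]; rewrite (spine_adj x0 s_inner s_neq0 s_max) //;
    last by rewrite sz; lia.
  by case/orP=> // /eqP <-.
- apply: (leaves_at_end s_inner s_neq0 s_max (j := (size s).-2)); rewrite ?sz; [lia|lia|].
  move=> y /(spineP x0)[j lt_j <-]; rewrite (spine_adj x0 s_inner s_neq0 s_max) //;
    last by rewrite sz; lia.
  by case/orP=> /eqP E; [lia|congr nth; lia].
- have lt1 : (1 < size s)%N by rewrite sz; lia.
  (* The two sets of leaves are disjoint, a pendant vertex having only one neighbour. *)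
  rewrite -cardP (pendant_leaves x0 s_inner s_neq0 s_max) cardsU.
  rewrite (_ : _ :&: _ = set0) ?cards0 ?subn0 //; apply/setP => v; rewrite in_setI in_set0 !mem_leaves_at.
  apply/negP => /andP[/andP[vP v0] /andP[_ vl]]; move: vl; rewrite adj_sym in v0.
  by rewrite adj_sym (pendant_adj _ vP v0) (spine_eq x0 s_inner); lia.
- exact: double_broom_iso.
Qed.
End Broom.

Theorem theorem2p4 (R : realType) (n k : nat) (hkn : (2 <= k <= n - 2)%N)
  (T : sgraph 'I_n) (hT : trees_with_pendants n k T)
  (hmax : forall T' : sgraph 'I_n,
     trees_with_pendants n k T' -> rhoL R T' <= rhoL R T) :
  exists t1 t2 : nat,
    [/\ (1 <= t1)%N, (1 <= t2)%N, (t1 + t2 = k)%N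
      & graph_iso T (double_broom n k t1 t2)].
Proof.
case: hT => treeT cardP; apply: (exists_double_broom_iso treeT) => //.
  by rewrite card_ord.
apply: (maximal_branching (R := R)) treeT _ => H treeH pendH.
by apply: hmax; split; rewrite ?pendH.
Qed.
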